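(* For every integer $n\ge3$, \[ C_{n,2}^{\rm loc}=\begin{cases}\dfrac12\sin^2\dfrac{\pi}{n}, & n\text{ odd},\\[1.2ex] 0, & n\text{ even}.\end{cases} \] Consequently, the equal point is a strict local minimum of $S_{n,2}$ modulo scaling for odd $n$, and it is quadratically degenerate for even $n$.
   Context: Indices are modulo $n$. For $x_i>0$, $S_{n,2}(x)=\sum_{i=1}^n\frac{x_i}{x_{i+1}+x_{i+2}}$, homogeneous of degree $0$. The equal point is $(1,\dots,1)$ (considered up to common scaling), where $S_{n,2}=n/2$. Define \[ C_{n,2}^{\rm loc}=\min_{1\le m\le n-1}\frac{|\lambda_{m}|^2-2\operatorname{Re}\lambda_{m}}{8},\qquad \lambda_{m}=e^{2\pi\mathrm{i} m/n}+e^{4\pi\mathrm{i} m/n}. \] ''Strict local minimum modulo scaling'' means: there is a neighbourhood $U$ of $(1,\dots,1)$ in the positive orthant such that $S_{n,2}(x)>n/2$ for every nonconstant $x\in U$. ''Quadratically degenerate'' means $C_{n,2}^{\rm loc}=0$, so that there are no $c>0$ and neighbourhood of $(1,\dots,1)$ on which $S_{n,2}(x)-\frac n2\ge c\sum_{i=1}^n(\log x_i-\overline{\log x})^2$, where $\overline{\log x}=\frac1n\sum_{i=1}^n\log x_i$. *)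

(* Defs.v *)
From mathcomp Require Import all_boot all_order all_algebra.
From mathcomp Require Import all_classical all_reals all_analysis.
From mathcomp Require Import complex.

Set Implicit Arguments.
Unset Strict Implicit.
Unset Printing Implicit Defensive.

Import Order.TTheory GRing.Theory Num.Theory.
Import numFieldNormedType.Exports.

Local Open Scope classical_set_scope.
Local Open Scope ring_scope.

Definition positive_orthant (R : realType) (n : nat) : set 'rV[R]_n :=
  [set x | forall i, 0 < x 0 i].

Definition nonconstant (R : realType) (n : nat) (x : 'rV[R]_n) : Prop :=
  ~ (forall i j, x 0 i = x 0 j).

(* [ordS] is the cyclic successor on ['I_n], so indices are modulo [n]. *)
Definition S2 (R : realType) (n : nat) (x : 'rV[R]_n) : R :=
  \sum_(i < n) x 0 i / (x 0 (ordS i) + x 0 (ordS (ordS i))).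

Definition equal_point (R : realType) (n : nat) : 'rV[R]_n := const_mx 1.

(* The complex exponential e^(i t) of a real angle [t]. *)
Definition expi (R : realType) (t : R) : R[i] := (cos t +i* sin t)%C.

Definition lambda (R : realType) (n m : nat) : R[i] :=
  expi (2 * pi * m%:R / n%:R : R) + expi (4 * pi * m%:R / n%:R).

Definition local_coef (R : realType) (n m : nat) : R :=
  (ComplexField.Normc.normc (lambda R n m) ^+ 2
     - 2 * complex.Re (lambda R n m)) / 8.

(* The default value is the term [m = 1]; for [2 <= n] it belongs to the range,
   so this is the minimum over [1 <= m <= n - 1]. *)
Definition C_loc (R : realType) (n : nat) : R :=
  \big[Num.min/local_coef R n 1]_(1 <= m < n) local_coef R n m.

Definition equal_point_nbhd (R : realType) (n : nat) (U : set 'rV[R]_n) : Prop :=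
  nbhs (equal_point R n) U /\ U `<=` @positive_orthant R n.

Definition strict_local_min_mod_scaling (R : realType) (n : nat) : Prop :=
  exists U : set 'rV[R]_n, equal_point_nbhd U /\
    forall x, U x -> nonconstant x -> n%:R / 2 < S2 x.

Definition quadratically_degenerate (R : realType) (n : nat) : Prop :=
  C_loc R n = 0.

Definition mean_log (R : realType) (n : nat) (x : 'rV[R]_n) : R :=
  n%:R^-1 * \sum_(i < n) ln (x 0 i).

Definition local_quadratic_bound (R : realType) (n : nat) : Prop :=
  exists (c : R) (U : set 'rV[R]_n), [/\ 0 < c, equal_point_nbhd U &
    forall x, U x ->
      c * (\sum_(i < n) (ln (x 0 i) - mean_log x) ^+ 2) <= S2 x - n%:R / 2].

(* Main.v *)
(* The coefficient of index [m] is [sin^2 (2 pi m / n) / 2]. For odd [n], [2 m]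
   is never a multiple of [n], and [sin^2 a - sin^2 b = sin (a + b) sin (a - b)]
   shows that the smallest value is the one at the angle [pi / n].
   For strict minimality, scale so that [x_0 = 1] and put [x = 1 + h] with
   [M = max |h_i|]. Up to terms that cancel in the cyclic sum and an error
   [O(n M^3)], [S - n / 2] is [1/8 * \sum_i (h_(i+2) - h_i)^2]. For odd [n] every
   index is reached from [0] by at most [n] double shifts, so this sum is at
   least [M^2 / n^2] and dominates the error near the equal point.
   For even [n], [S = n / 2] exactly at the points [(a, b, a, b, ...)]. *)
Require Import Defs.
From mathcomp Require Import all_boot all_order all_algebra.
From mathcomp Require Import all_classical all_reals all_analysis.
From mathcomp Require Import complex.
From mathcomp Require Import ring lra zify.

Import Order.TTheory GRing.Theory Num.Theory.
Import numFieldNormedType.Exports.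

Local Open Scope ring_scope.

(** * Trigonometric evaluation of the local coefficients *)

Lemma sin2B (R : realType) (a b : R) :
  sin a ^+ 2 - sin b ^+ 2 = sin (a + b) * sin (a - b).
Proof.
rewrite sinD sinB.
have -> : (sin a * cos b + cos a * sin b) * (sin a * cos b - cos a * sin b)
  = sin a ^+ 2 * cos b ^+ 2 - cos a ^+ 2 * sin b ^+ 2 by ring.
by rewrite !cos2sin2; ring.
Qed.

Lemma sin2Dpi (R : realType) (a : R) : sin (a + pi) ^+ 2 = sin a ^+ 2.
Proof. by rewrite sinDpi sqrrN. Qed.

(** For [t = 2 pi m / n], the squared modulus is [2 + 2 cos t]; subtracting twice the real part
    cancels [cos t] and leaves [2 - 2 cos (2 t) = 4 sin^2 t]. *)
Lemma local_coefE (R : realType) (n m : nat) :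
  local_coef R n m = sin (2 * pi * m%:R / n%:R) ^+ 2 / 2.
Proof.
rewrite /local_coef /lambda /expi.
set t : R := 2 * pi * m%:R / n%:R.
have -> : 4 * pi * m%:R / n%:R = t *+ 2 by rewrite /t -[RHS]mulr_natl; ring.
rewrite /= sqr_sqrtr; last by rewrite addr_ge0 // sqr_ge0.
rewrite cos_mulr2n sin_mulr2n.
have -> : (sin t + (cos t * sin t) *+ 2) ^+ 2
    = sin t ^+ 2 * (1 + 2 * cos t) ^+ 2 by ring.
by rewrite sin2cos2; field.
Qed.

(** By [sin2B] the difference is a product of sines at [pi (r + 1) / n] and [pi (r - 1) / n], and
    both angles lie in [[0, pi]]. *)
Lemma sin2_pi_frac_ge (R : realType) (n r : nat) : (0 < r < n)%N ->
  sin (pi / n%:R : R) ^+ 2 <= sin (pi * r%:R / n%:R) ^+ 2.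
Proof.
move=> /andP[r0 rn].
have n0 : (0 : R) < n%:R by rewrite ltr0n; lia.
have pi0 := pi_ge0 R.
have r1 : (1 : R) <= r%:R by rewrite ler1n.
have rn' : (r%:R + 1 : R) <= n%:R by rewrite natr1 ler_nat.
have arg_in (t : R) : 0 <= t <= n%:R -> 0 <= pi * t / n%:R <= pi.
  move=> /andP[t0 tn]; rewrite divr_ge0 ?mulr_ge0 ?(ltW n0) //=.
  by rewrite ler_pdivrMr // ler_wpM2l.
rewrite -subr_ge0 sin2B -mulrDl -mulrBl -{2 4}(mulr1 pi) -mulrDr -mulrBr.
by rewrite mulr_ge0 // sin_ge0_pi // arg_in //; apply/andP; split; lra.
Qed.

Lemma local_coef_ge_odd (R : realType) (n m : nat) : odd n -> (1 <= m < n)%N ->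
  1 / 2 * sin (pi / n%:R) ^+ 2 <= local_coef R n m.
Proof.
move=> on /andP[m1 mn].
have n0 : (n%:R : R) != 0 by rewrite pnatr_eq0; lia.
rewrite local_coefE mulrC mul1r ler_pM2r ?invr_gt0 //.
(* As [n] is odd, [2 m] differs from [n], so [2 m] or [2 m - n] lies strictly between [0] and [n];
   [sin^2] has period [pi]. *)
case: (ltnP (m.*2) n) => [lt2|ge2].
  have -> : 2 * pi * m%:R / n%:R = pi * m.*2%:R / n%:R :> R.
    by rewrite -mul2n natrM; ring.
  by apply: sin2_pi_frac_ge; lia.
have -> : 2 * pi * m%:R / n%:R = pi * (m.*2 - n)%:R / n%:R + pi :> R.
  by rewrite natrB // -mul2n natrM; field.
by rewrite sin2Dpi; apply: sin2_pi_frac_ge; lia.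
Qed.

Lemma C_loc_odd (R : realType) (n : nat) : (3 <= n)%N -> odd n ->
  C_loc R n = 1 / 2 * sin (pi / n%:R) ^+ 2.
Proof.
move=> hn on; apply/eqP; rewrite eq_le; apply/andP; split; last first.
  rewrite /C_loc big_nat_cond; apply: le_bigmin.
    (* The default value, the coefficient at [m = 1], must obey the bound too. *)
    by apply: local_coef_ge_odd => //; lia.
  by move=> m /andP[hm _]; apply: local_coef_ge_odd.
(* At [m = (n - 1) / 2] the angle is [pi - pi / n]. *)
apply: (@bigmin_inf_seq _ _ _ _ _ n./2) => //.
  by rewrite mem_index_iota; lia.
rewrite local_coefE.
have n0 : (n%:R : R) != 0 by rewrite pnatr_eq0; lia.
have -> : 2 * pi * n./2%:R / n%:R = - (pi / n%:R) + pi :> R.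
  have -> : (n%:R : R) = 1 + 2 * n./2%:R.
    by rewrite -{1}(odd_double_half n) on natrD -mul2n natrM.
  have : (1 + 2 * n./2%:R : R) != 0.
    by rewrite gt_eqF // ltr_wpDr // mulr_ge0.
  by move=> ?; field.
by rewrite sin2Dpi sinN sqrrN mulrC mul1r.
Qed.

Lemma C_loc_even (R : realType) (n : nat) : (3 <= n)%N -> ~~ odd n ->
  C_loc R n = 0.
Proof.
move=> hn en; apply/eqP; rewrite eq_le; apply/andP; split; last first.
  by apply: le_bigmin => [|m _]; rewrite local_coefE divr_ge0 ?sqr_ge0.
apply: (@bigmin_inf_seq _ _ _ _ _ n./2) => //.
  by rewrite mem_index_iota; lia.
rewrite local_coefE.
have nE : (n%:R : R) = 2 * n./2%:R.
  by rewrite -{1}(odd_double_half n) (negbTE en) add0n -mul2n natrM.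
have h0 : (n./2%:R : R) != 0 by rewrite pnatr_eq0; lia.
have -> : 2 * pi * n./2%:R / n%:R = pi :> R by rewrite nE; field.
by rewrite sinpi expr0n mul0r.
Qed.

(** * Second-order expansion and strict minimality for odd [n] *)

Lemma sum_ordS_telescope (R : realType) (n : nat) (f : 'I_n -> R) :
  \sum_(i < n) (f (ordS i) - f i) = 0.
Proof.
by rewrite sumrB [X in _ - X](reindex_inj (@ordS_inj n)) /= subrr.
Qed.

Definition boundary_term {R : realType} (u v : R) : R :=
  u ^+ 2 / 8 + u * v / 4 - u / 2 - v / 4.

(* With [k = (b + c) / 2], expand
   [(1 + a) / (1 + k) = 1 + (a - k) - (a - k) k + (a - k) k^2 / (1 + k)];
   the first- and second-order part is [(c - a)^2 / 4] up to
   [2 (boundary_term b c - boundary_term a b)], which vanishes in the cyclic sum. *)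
Lemma S2_term_ge {R : realType} {a b c M : R} : M <= 1 / 2 ->
  `|a| <= M -> `|b| <= M -> `|c| <= M ->
  1 / 2 + (c - a) ^+ 2 / 8 + (boundary_term b c - boundary_term a b)
    - 2 * M ^+ 3
  <= (1 + a) / ((1 + b) + (1 + c)).
Proof.
move=> M2; rewrite !ler_norml => /andP[a1 a2] /andP[b1 b2] /andP[c1 c2].
set k := (b + c) / 2.
have k1 : - M <= k by rewrite /k; lra.
have k2 : k <= M by rewrite /k; lra.
have den : 1 / 2 <= 1 + k by lra.
have -> : (1 + a) / ((1 + b) + (1 + c)) = 1 / 2 + (c - a) ^+ 2 / 8
    + (boundary_term b c - boundary_term a b) + (a - k) * k ^+ 2 / (2 * (1 + k)).
  by rewrite /boundary_term /k; field; rewrite gt_eqF //; rewrite /k in den; lra.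
rewrite lerD2l.
(* The remainder is controlled by [|a - k| <= 2 M], [k^2 <= M^2] and [2 (1 + k) >= 1]. *)
rewrite ler_pdivlMr; last by lra.
have kM : k ^+ 2 <= M ^+ 2.
  by rewrite -subr_ge0 subr_sqr mulr_ge0 //; lra.
have M0 : 0 <= M by lra.
have : - (2 * M ^+ 3) <= (a - k) * k ^+ 2.
  have -> : - (2 * M ^+ 3) = - (2 * M) * M ^+ 2 by ring.
  have := sqr_ge0 k; nra.
have := exprn_ge0 3 M0; nra.
Qed.

Lemma val_iter_ordS (n j : nat) (i : 'I_n) :
  val (iter j (@ordS n) i) = ((i + j) %% n)%N.
Proof.
elim: j => [|j IH] /=; first by rewrite addn0 modn_small.
by rewrite IH -addn1 modnDml addn1 addnS.
Qed.

(* For odd [n] the double shift generates the cyclic group. *)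
Lemma double_shift_reach (n : nat) (i0 i : 'I_n) : odd n ->
  exists2 j, (j <= n)%N & i = iter j (fun l => ordS (ordS l)) i0.
Proof.
move=> on.
have iterE j : iter j (fun l => ordS (ordS l)) i0 = iter j.*2 (@ordS n) i0.
  by elim: j => //= j ->.
pose d := (i + n - i0)%N.
have dE : ((i0 + d) %% n = i)%N.
  by rewrite subnKC ?modnDr ?modn_small // ltnW // ltn_addl.
have di : (d < n.*2)%N by rewrite /d; have := ltn_ord i; lia.
(* An odd offset [d] becomes even on adding or subtracting the odd [n]; the choice keeps the number
   of double shifts at most [n]. *)
case: (boolP (odd d)) => od.
  case: (ltnP d n) => dn.
    exists ((d + n)./2); first by lia.
    rewrite iterE; apply: val_inj; rewrite val_iter_ordS.
    have -> : ((d + n)./2.*2 = d + n)%N by lia.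
    by rewrite addnA modnDr.
  exists ((d - n)./2); first by lia.
  rewrite iterE; apply: val_inj; rewrite val_iter_ordS.
  have -> : ((d - n)./2.*2 = d - n)%N by lia.
  by rewrite -(modnDr _ n) -addnA subnK.
exists (d./2); first by lia.
rewrite iterE; apply: val_inj; rewrite val_iter_ordS.
by have -> : (d./2.*2 = d)%N by lia.
Qed.

(** Each double shift changes [h] by at most [sqrt E], and at most [n] of them lead from the zero at
    [i0] to [i]. *)
Lemma sqr_le_sum_double_shift {R : realType} {n : nat} {h : 'I_n -> R} {i0} :
  odd n -> h i0 = 0 -> forall i,
  h i ^+ 2 <= n%:R ^+ 2 * \sum_(l < n) (h (ordS (ordS l)) - h l) ^+ 2.
Proof.
move=> on h0 i; set E := \sum_(l < n) _.
have E0 : 0 <= E by apply: sumr_ge0 => l _; apply: sqr_ge0.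
have step l : `|h (ordS (ordS l)) - h l| <= Num.sqrt E.
  rewrite -sqrtr_sqr ler_wsqrtr // /E (bigD1 l) //= lerDl.
  by apply: sumr_ge0 => ? _; apply: sqr_ge0.
have iterP j : `|h (iter j (fun l => ordS (ordS l)) i0)| <= j%:R * Num.sqrt E.
  elim: j => [|j IH] /=; first by rewrite h0 normr0 mul0r.
  rewrite -natr1 mulrDl mul1r -[X in h X]/(ordS (ordS _)).
  set l := iter j _ _ in IH *.
  rewrite -(subrK (h l) (h _)) addrC.
  by apply: le_trans (ler_normD _ _) _; apply: lerD.
have [j jn ->] := double_shift_reach n i0 i on.
rewrite -real_normK ?num_real // -(sqr_sqrtr E0) -exprMn.
rewrite ler_sqr ?nnegrE ?mulr_ge0 ?sqrtr_ge0 //.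
apply: le_trans (iterP j) _.
by rewrite ler_wpM2r ?sqrtr_ge0 // ler_nat.
Qed.

Lemma S2_scale (R : realType) (n : nat) (t : R) (x : 'rV[R]_n) : t != 0 ->
  S2 (t *: x) = S2 x.
Proof.
move=> t0; apply: eq_bigr => i _.
by rewrite !mxE -mulrDr -mulf_div divff // mul1r.
Qed.

Lemma S2_gt_near {R : realType} {n : nat} {x : 'rV[R]_n} (i0 : 'I_n) : odd n ->
  x 0 i0 = 1 -> nonconstant x ->
  (forall i, `|x 0 i - 1| < (16 * n%:R ^+ 3)^-1) -> n%:R / 2 < S2 x.
Proof.
move=> on x0 ncst xM.
pose h i := x 0 i - 1.
have n1 : (1 : R) <= n%:R by rewrite ler1n; lia.
have n0 : (0 : R) < n%:R by lra.
have n3 : (1 : R) <= n%:R ^+ 3 by rewrite exprn_ege1.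
pose M := \big[Num.max/0]_i `|h i|.
have hM i : `|h i| <= M by apply: le_bigmax.
have Mlt : M < (16 * n%:R ^+ 3)^-1.
  by apply: bigmax_lt => [|i _]; [rewrite invr_gt0; lra | exact: xM].
have Mn : 16 * n%:R ^+ 3 * M < 1.
  by rewrite mulrC -ltr_pdivlMr ?div1r //; lra.
have Mge0 : 0 <= M by apply: bigmax_ge_id.
have M2 : M <= 1 / 2 by nra.
have M0 : 0 < M.
  rewrite lt_neqAle Mge0 andbT; apply/eqP => M0; apply: ncst.
  have xi i : x 0 i = 1.
    apply/eqP; rewrite -subr_eq0 -normr_le0.
    by rewrite M0; apply: hM.
  by move=> i j; rewrite !xi.
pose E := \sum_(l < n) (h (ordS (ordS l)) - h l) ^+ 2.
have ME : M ^+ 2 <= n%:R ^+ 2 * E.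
  have [i _ ->] : {i | i \in predT & M = `|h i|}.
    by apply: (eq_bigmax i0) => // i _; apply: normr_ge0.
  rewrite real_normK ?num_real //.
  by apply: (sqr_le_sum_double_shift (i0 := i0)) => //; rewrite /h x0 subrr.
have SE : n%:R / 2 + E / 8 - 2 * n%:R * M ^+ 3 <= S2 x.
  pose f i := boundary_term (h i) (h (ordS i)).
  have -> : n%:R / 2 + E / 8 - 2 * n%:R * M ^+ 3 =
    \sum_(i < n) (1 / 2 + (h (ordS (ordS i)) - h i) ^+ 2 / 8
      + (f (ordS i) - f i) - 2 * M ^+ 3).
    rewrite sumrB 2!big_split /= sum_ordS_telescope.
    by rewrite !sumr_const card_ord -mulr_suml -/E; ring.
  apply: ler_sum => i _.
  apply: le_trans (S2_term_ge M2 (hM i) (hM _) (hM _)) _.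
  by rewrite /h !subrKC.
apply: lt_le_trans SE.
rewrite -addrA ltrDl subr_gt0.
(* After scaling by [n^2], the main term is at least [M^2 / 8], and the error is [16 n^3 M] times
   [M^2 / 8], with factor below 1 by [Mn]. *)
rewrite -(ltr_pM2l (exprn_gt0 2 n0)).
have : n%:R ^+ 2 * (2 * n%:R * M ^+ 3) = (16 * n%:R ^+ 3 * M) * M ^+ 2 / 8 by field.
have : 0 < M ^+ 2 by rewrite exprn_gt0.
nra.
Qed.

Lemma strict_local_min_odd (R : realType) (n : nat) : odd n ->
  strict_local_min_mod_scaling R n.
Proof.
move=> on.
have n1 : (1 : R) <= n%:R by rewrite ler1n; lia.
have n3 : (1 : R) <= n%:R ^+ 3 by rewrite exprn_ege1.
(* A quarter of the radius in [S2_gt_near]: dividing by [x 0 i0] leaves deviations below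
   [2 e / (1 - e) < 4 e]. *)
pose e : R := (64 * n%:R ^+ 3)^-1.
have ep : 0 < e by rewrite invr_gt0; lra.
have ee : e * (64 * n%:R ^+ 3) = 1 by rewrite mulVf // gt_eqF //; lra.
have e1 : e <= 1 / 64 by nra.
exists (ball (equal_point R n) e); split; first split.
- exact: nbhsx_ballx.
- move=> x [_ xe] i; have := xe 0 i.
  by rewrite /ball /= mxE ltr_norml => /andP[? ?]; lra.
move=> x [_ xe] ncst.
have xi i : 1 - e < x 0 i < 1 + e.
  have := xe 0 i; rewrite /ball /= mxE ltr_norml => /andP[? ?].
  by apply/andP; split; lra.
have n0 : (0 < n)%N by lia.
pose i0 := Ordinal n0.
have /andP[l0 u0] := xi i0.
have p0 : 0 < x 0 i0 by lra.
rewrite -(@S2_scale _ _ (x 0 i0)^-1) ?invr_eq0 ?gt_eqF //.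
apply: (S2_gt_near i0) => //.
- by rewrite mxE mulVf // gt_eqF.
- move=> cst; apply: ncst => i j; have := cst i j; rewrite !mxE.
  by apply: mulfI; rewrite invr_eq0 gt_eqF.
move=> i; rewrite mxE.
have -> : (x 0 i0)^-1 * x 0 i - 1 = (x 0 i - x 0 i0) / x 0 i0.
  by rewrite mulrBl divff ?gt_eqF // mulrC.
have -> : (16 * n%:R ^+ 3)^-1 = 4 * e.
  by rewrite /e; field; rewrite gt_eqF //; lra.
rewrite normf_div (gtr0_norm p0) ltr_pdivrMr // ltr_norml.
have /andP[? ?] := xi i.
by apply/andP; split; nra.
Qed.

(** * Degeneracy for even [n] *)

Definition alternating_point (R : realType) (n : nat) (e : R) : 'rV[R]_n :=
  \row_i (if odd i then 1 + e else 1).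

(** For even [n] the wraparound from [n - 1] to [0] also flips parity. *)
Lemma odd_ordS (n : nat) (i : 'I_n) : ~~ odd n -> odd (ordS i) = ~~ odd i.
Proof.
move=> en /=; have := ltn_ord i; rewrite leq_eqVlt => /orP[/eqP iE|iE].
  by rewrite iE modnn; lia.
by rewrite modn_small.
Qed.

Lemma S2_alternating (R : realType) (n : nat) (e : R) : ~~ odd n -> 0 < e ->
  S2 (alternating_point R n e) = n%:R / 2.
Proof.
move=> en e0; pose x := alternating_point R n e.
(* Neighbouring entries always sum to [2 + e], so each term is [1 / 2] plus a telescoping
   difference. *)
have term i : x 0 i / (x 0 (ordS i) + x 0 (ordS (ordS i))) =
    1 / 2 + ((x 0 i - x 0 (ordS i)) / (2 * (2 + e))).
  by rewrite !mxE !odd_ordS //; case: (odd i) => /=; field;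
    rewrite !gt_eqF //; lra.
rewrite /S2 (eq_bigr _ (fun i _ => term i)) big_split /=.
rewrite sumr_const card_ord -mulr_suml.
under [X in _ + X / _]eq_bigr do rewrite -opprB.
by rewrite sumrN sum_ordS_telescope oppr0 mul0r addr0 -mulrnAl.
Qed.

Lemma no_quadratic_bound_even (R : realType) (n : nat) : (2 <= n)%N ->
  ~~ odd n -> ~ local_quadratic_bound R n.
Proof.
move=> hn en [c [U [c0 [/nbhs_ballP[e /= e0 eU] Upos]]]] bound.
pose x := alternating_point R n (e / 2).
have Ux : U x.
  apply: eU; split => // i j; rewrite /ball /= !mxE ltr_norml.
  by case: ifP => _; apply/andP; split; lra.
(* Here [S2] equals [n / 2], so the bound forces all logarithms to agree, although entries 0 and 1
   differ. *)
have := bound x Ux; rewrite S2_alternating //; last by lra.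
rewrite subrr pmulr_rle0 // => s0.
have sq_ge0 (i : 'I_n) : true -> 0 <= (ln (x 0 i) - mean_log x) ^+ 2.
  by move=> _; apply: sqr_ge0.
have /eqP : \sum_(i < n) (ln (x 0 i) - mean_log x) ^+ 2 = 0.
  by apply/eqP; rewrite eq_le s0 sumr_ge0.
rewrite psumr_eq0 // => /allP lnE.
have lnx i : ln (x 0 i) = mean_log x.
  have := lnE i (mem_index_enum i); rewrite /= sqrf_eq0 subr_eq0.
  by move/eqP.
have n0 : (0 < n)%N by lia.
have := ln_inj (Upos x Ux (Ordinal n0)) (Upos x Ux (Ordinal hn)).
by rewrite !lnx !mxE /= => /(_ erefl); lra.
Qed.

Theorem theorem10p1 (R : realType) (n : nat) (hn : (3 <= n)%N) :
  [/\ C_loc R n = (if odd n then 1 / 2 * sin (pi / n%:R) ^+ 2 else 0),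
      odd n -> strict_local_min_mod_scaling R n &
      ~~ odd n -> quadratically_degenerate R n /\ ~ local_quadratic_bound R n].
Proof.
split.
- case: ifPn => on; [exact: C_loc_odd | exact: C_loc_even].
- exact: strict_local_min_odd.
- move=> en; split; first exact: C_loc_even.
  by apply: no_quadratic_bound_even => //; lia.
Qed.
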